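(* Let $G_2$ be an abelian group acting trivially on an abelian group $G_1$, and let $\varepsilon_1,\varepsilon_2\in Z^2(G_2,G_1)$. The groups $G_1\underset{\varepsilon_1}{\times}G_2$ and $G_1\underset{\varepsilon_2}{\times}G_2$ are $(G_1,G_2)$-isomorphic if and only if $\varepsilon_1=1$ and there exists an isomorphism $\delta:G_1\to G_2$ such that $\varepsilon_2\circ(\delta\times\delta)=1$.
   Context: Groups are written multiplicatively; $1$ also denotes the constant map with value $1$. $Z^2(G_2,G_1)$ is the group of normalized 2-cocycles: maps $\varepsilon:G_2\times G_2\to G_1$ with $\varepsilon(h,g)\varepsilon(hg,k)=\varepsilon(g,k)\varepsilon(h,gk)$ for all $g,h,k\in G_2$ and $\varepsilon(g,1)=\varepsilon(1,g)=1$ for all $g\in G_2$. For $\varepsilon\in Z^2(G_2,G_1)$, the central extension $G_1\underset{\varepsilon}{\times}G_2$ is the set $G_1\times G_2$ with the group operation $(x,y)(x',y')=(xx'\varepsilon(y,y'),yy')$. For a homomorphism $\varphi:G_1\underset{\varepsilon_1}{\times}G_2\to G_1\underset{\varepsilon_2}{\times}G_2$ put $\varphi_{ij}=pr_i\circ\varphi\circ t_j:G_j\to G_i$, where $pr_i$ is the projection onto the $i$-th coordinate and $t_1(x)=(x,1)$, $t_2(y)=(1,y)$. An isomorphism $\varphi$ is a $(G_i)$-isomorphism if $\varphi_{ii}=1$. The two groups are $(G_1,G_2)$-isomorphic if there exists an isomorphism $\varphi$ from $G_1\underset{\varepsilon_1}{\times}G_2$ to $G_1\underset{\varepsilon_2}{\times}G_2$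 that is both a $(G_1)$-isomorphism and a $(G_2)$-isomorphism, i.e. $\varphi_{11}=1$ and $\varphi_{22}=1$. *)

(* Defs.v *)
From HB Require Import structures.
From mathcomp Require Import all_boot.
Set Implicit Arguments.
Unset Strict Implicit.
Unset Printing Implicit Defensive.
Local Open Scope group_scope.

HB.mixin Record Group_isAbelian G of Group G := {
  abel_mulgC : commutative (@mul G)
}.

#[short(type="abelGroupType")]
HB.structure Definition AbelGroup := {G of Group G & Group_isAbelian G}.

(* Normalized 2-cocycles of G2 in G1, for the trivial action of G2 on G1. *)
Record cocycle2 (G2 : groupType) (G1 : abelGroupType) := Cocycle2 {
  cocycle2_fun :> G2 -> G2 -> G1;
  cocycle2P : forall g h k : G2,
    cocycle2_fun h g * cocycle2_fun (h * g) k
    = cocycle2_fun g k * cocycle2_fun h (g * k);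
  cocycle2_g1 : forall g : G2, cocycle2_fun g 1 = 1;
  cocycle2_1g : forall g : G2, cocycle2_fun 1 g = 1
}.

(* A record rather than an alias of G1 * G2, so that the twisted product below *)
(* cannot be confused with the library's direct product structure on pairs.    *)
Record central_ext (G1 : abelGroupType) (G2 : groupType) (e : cocycle2 G2 G1) :=
  CExt { pr1 : G1; pr2 : G2 }.

Section CentralExt.
Variables (G1 : abelGroupType) (G2 : groupType) (e : cocycle2 G2 G1).
Implicit Types (p q : central_ext e) (x : G1) (y : G2).

Definition cext_to_pair p : G1 * G2 := (pr1 p, pr2 p).
Definition pair_to_cext (u : G1 * G2) : central_ext e := CExt e u.1 u.2.

Lemma cext_to_pairK : cancel cext_to_pair pair_to_cext.
Proof. by case. Qed.

HB.instance Definition _ := Choice.copy (central_ext e) (can_type cext_to_pairK).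

Definition cext_mul p q : central_ext e :=
  CExt e (pr1 p * pr1 q * e (pr2 p) (pr2 q)) (pr2 p * pr2 q).
Definition cext_one : central_ext e := CExt e 1 1.
Definition cext_inv p : central_ext e :=
  CExt e ((pr1 p)^-1 * (e (pr2 p)^-1 (pr2 p))^-1) (pr2 p)^-1.

Lemma cext_mulA : associative cext_mul.
Proof.
move=> [x y] [x' y'] [x'' y'']; rewrite /cext_mul /=.
congr CExt; last exact: mulgA.
rewrite -!mulgA; congr (_ * (_ * _)).
by rewrite -cocycle2P abel_mulgC -mulgA (abel_mulgC x'').
Qed.

Lemma cext_mul1 : left_id cext_one cext_mul.
Proof. by case=> x y; rewrite /cext_mul /= cocycle2_1g !mul1g mulg1. Qed.

Lemma cext_mulr1 : right_id cext_one cext_mul.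
Proof. by case=> x y; rewrite /cext_mul /= cocycle2_g1 !mulg1. Qed.

Lemma cext_mulV : left_inverse cext_one cext_inv cext_mul.
Proof.
case=> x y; rewrite /cext_mul /cext_one /= mulVg; congr CExt.
by rewrite [_^-1 * _]abel_mulgC mulgVK mulVg.
Qed.

Lemma cext_mulrV : right_inverse cext_one cext_inv cext_mul.
Proof.
case=> x y; rewrite /cext_mul /cext_one /= mulgV; congr CExt.
have eV : e y y^-1 = e y^-1 y.
  have := cocycle2P e y^-1 y y.
  by rewrite mulgV mulVg cocycle2_1g cocycle2_g1 !mulg1.
by rewrite mulgA mulgV mul1g eV mulVg.
Qed.

HB.instance Definition _ := isGroup.Build (central_ext e)
  cext_mulA cext_mul1 cext_mulr1 cext_mulV cext_mulrV.

Definition t1 x : central_ext e := CExt e x 1.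
Definition t2 y : central_ext e := CExt e 1 y.

End CentralExt.

Section Isomorphisms.
Variables (G1 : abelGroupType) (G2 : groupType) (e1 e2 : cocycle2 G2 G1).
Implicit Type phi : {multiplicative central_ext e1 -> central_ext e2}.

Definition hom11 phi : G1 -> G1 := @pr1 _ _ e2 \o phi \o @t1 _ _ e1.
Definition hom22 phi : G2 -> G2 := @pr2 _ _ e2 \o phi \o @t2 _ _ e1.

Definition G1_isomorphism phi : Prop := bijective phi /\ hom11 phi =1 (fun=> 1).
Definition G2_isomorphism phi : Prop := bijective phi /\ hom22 phi =1 (fun=> 1).

Definition G1G2_isomorphic : Prop :=
  exists phi : {multiplicative central_ext e1 -> central_ext e2},
    G1_isomorphism phi /\ G2_isomorphism phi.

End Isomorphisms.

(* Main.v *)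
Require Import Defs.
From HB Require Import structures.
From mathcomp Require Import all_boot.
Set Implicit Arguments.
Unset Strict Implicit.
Unset Printing Implicit Defensive.
Local Open Scope group_scope.

(** Write [delta] for [hom21 phi] and [gamma] for [hom12 phi].
    A homomorphism [phi] between the two extensions whose diagonal components are
    both trivial exchanges the two coordinates: it has the form
    [(x, y) |-> (gamma y, delta x)] ([antidiag_swap]), because it does so on
    the elements [(x, 1)] and [(1, y)], whose products are all of the extension.
    Comparing coordinates in the image of a product, such a map is
    multiplicative exactly when
      [gamma (y y') = gamma y * gamma y' * e2 (delta x) (delta x')] and
      [delta (x x' * e1 y y') = delta x * delta x']
    for all arguments.  The first equation with [y = y' = 1] says that [e2] is
    trivial on the image of [delta]; the right-hand side of the second does not
    involve [y] and [y'], so [delta] is a homomorphism that kills the values of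
    [e1].  When the map is bijective, so is [delta], and then [e1 = 1].
    Conversely, if [e1 = 1] and [delta] is an isomorphism along which [e2]
    becomes trivial, both equations hold with [gamma = delta^-1]. *)

(** [{multiplicative G -> H}] is the type of magma morphisms, which need not
    preserve units; here cancellation in [H] gives it. *)
Lemma mulhom1 (G H : groupType) (f : {multiplicative G -> H}) : f 1 = 1.
Proof. by apply: (mulgI (f 1)); rewrite -gmulfM !mulg1. Qed.

Lemma cext_mulE (G1 : abelGroupType) (G2 : groupType) (e : cocycle2 G2 G1)
    (p q : central_ext e) :
  p * q = CExt e (pr1 p * pr1 q * e (pr2 p) (pr2 q)) (pr2 p * pr2 q).
Proof. by []. Qed.

Lemma cext_split (G1 : abelGroupType) (G2 : groupType) (e : cocycle2 G2 G1)
    (p : central_ext e) :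
  t1 e (pr1 p) * t2 e (pr2 p) = p.
Proof. by case: p => x y; rewrite cext_mulE /= cocycle2_1g !mulg1 mul1g. Qed.

Section AntidiagonalMorphism.

Variables (G1 G2 : abelGroupType) (e1 e2 : cocycle2 G2 G1).
Variable phi : {multiplicative central_ext e1 -> central_ext e2}.
Hypothesis phi11 : hom11 phi =1 (fun=> 1).
Hypothesis phi22 : hom22 phi =1 (fun=> 1).

Definition hom21 (x : G1) : G2 := pr2 (phi (t1 e1 x)).
Definition hom12 (y : G2) : G1 := pr1 (phi (t2 e1 y)).

Lemma antidiag_swap p : phi p = CExt e2 (hom12 (pr2 p)) (hom21 (pr1 p)).
Proof.
have t1E x : phi (t1 e1 x) = CExt e2 1 (hom21 x).
  by rewrite -[X in CExt _ X](phi11 x) /hom11 /hom21 /=; case: (phi _).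
have t2E y : phi (t2 e1 y) = CExt e2 (hom12 y) 1.
  by rewrite -[X in CExt _ _ X](phi22 y) /hom22 /hom12 /=; case: (phi _).
rewrite -[in LHS](cext_split p) gmulfM t1E t2E cext_mulE /=.
by rewrite cocycle2_g1 !mulg1 mul1g.
Qed.

(** The two coordinates of [phi ((x, y) * (x', y'))]. *)
Lemma antidiag_mul x x' y y' :
  hom12 (y * y') = hom12 y * hom12 y' * e2 (hom21 x) (hom21 x') /\
  hom21 (x * x' * e1 y y') = hom21 x * hom21 x'.
Proof.
have := gmulfM (s := phi) (CExt e1 x y) (CExt e1 x' y').
by rewrite !antidiag_swap !cext_mulE /= => -[-> ->].
Qed.

Lemma hom12_1 : hom12 1 = 1.
Proof. by rewrite /hom12 (_ : t2 e1 1 = 1) ?mulhom1. Qed.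

Lemma hom21_1 : hom21 1 = 1.
Proof. by rewrite /hom21 (_ : t1 e1 1 = 1) ?mulhom1. Qed.

Lemma antidiag_cocycle_target x x' : e2 (hom21 x) (hom21 x') = 1.
Proof.
by have [] := antidiag_mul x x' 1 1; rewrite mulg1 hom12_1 !mul1g => ->.
Qed.

Lemma antidiag_hom21M : {morph hom21 : x x' / x * x'}.
Proof.
by move=> x x'; have [_] := antidiag_mul x x' 1 1; rewrite cocycle2_1g mulg1.
Qed.

Lemma antidiag_cocycle_source y y' : hom21 (e1 y y') = 1.
Proof.
by have [_] := antidiag_mul 1 1 y y'; rewrite hom21_1 !mul1g.
Qed.

(** If [phi (x, y) = (1, z)] then [delta x = z], whatever [y] is; so the inverse
    of [delta] is read off from the inverse of [phi] on the elements [(1, z)]. *)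
Lemma antidiag_hom21_bij : bijective phi -> bijective hom21.
Proof.
case=> psi phiK psiK; exists (fun z => pr1 (psi (CExt e2 1 z))) => [x | z].
  have -> : CExt e2 1 (hom21 x) = phi (t1 e1 x).
    by rewrite antidiag_swap /= hom12_1.
  by rewrite phiK.
by have := psiK (CExt e2 1 z); rewrite antidiag_swap => -[_].
Qed.

End AntidiagonalMorphism.

Section SwapIsomorphism.

Variables (G1 G2 : abelGroupType) (e1 e2 : cocycle2 G2 G1).
Variables (delta : {multiplicative G1 -> G2}) (gamma : G2 -> G1).
Hypothesis deltaK : cancel delta gamma.
Hypothesis gammaK : cancel gamma delta.
Hypothesis e1_1 : forall y y', e1 y y' = 1.
Hypothesis e2_1 : forall x x', e2 (delta x) (delta x') = 1.

Definition swap_cext (p : central_ext e1) : central_ext e2 :=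
  CExt e2 (gamma (pr2 p)) (delta (pr1 p)).

Lemma swap_cextM : {morph swap_cext : p q / p * q}.
Proof.
move=> p q; rewrite /swap_cext !cext_mulE /= e1_1 e2_1 !mulg1 gmulfM.
by rewrite (can2_gmulfM deltaK gammaK).
Qed.

Lemma swap_cext_bij : bijective swap_cext.
Proof.
exists (fun q => CExt e1 (gamma (pr2 q)) (delta (pr1 q))) => -[a b];
  by rewrite /swap_cext /= deltaK gammaK.
Qed.

HB.instance Definition _ :=
  isMultiplicative.Build (central_ext e1) (central_ext e2) swap_cext swap_cextM.

Lemma swap_G1G2_isomorphic : G1G2_isomorphic e1 e2.
Proof.
exists swap_cext; split; split; try exact: swap_cext_bij.
  by move=> x; rewrite /hom11 /= -[1 in LHS](mulhom1 delta) deltaK.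
by move=> y; rewrite /hom22 /= mulhom1.
Qed.

End SwapIsomorphism.

Theorem corollary6p6 (G1 G2 : abelGroupType) (e1 e2 : cocycle2 G2 G1) :
  G1G2_isomorphic e1 e2 <->
  (forall g h : G2, e1 g h = 1) /\
  (exists delta : {multiplicative G1 -> G2},
     bijective delta /\ forall x x' : G1, e2 (delta x) (delta x') = 1).
Proof.
split=> [[phi [[phi_bij phi11] [_ phi22]]] | [e1_1 [delta [[gamma dK gK] e2_1]]]].
  have delta_bij := antidiag_hom21_bij phi11 phi22 phi_bij.
  split=> [y y' | ].
    apply: (bij_inj delta_bij).
    by rewrite (antidiag_cocycle_source phi11 phi22) hom21_1.
  pose deltaM := isMultiplicative.Build G1 G2 _
    (antidiag_hom21M phi11 phi22).
  exists (HB.pack_for {multiplicative G1 -> G2} (hom21 phi) deltaM); split=> // x x'.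
  exact: antidiag_cocycle_target phi11 phi22 x x'.
exact: swap_G1G2_isomorphic dK gK e1_1 e2_1.
Qed.
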